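(* Let $G=(V,E)$ be a finite connected simple graph on $n$ vertices, let $\mathbf{U}$ be a universal adjacency matrix of $G$, let $\lambda\in\mathrm{spec}(\mathbf{U})$, and let $|CV_\lambda|=k$, where $1\le k\le n$. Then $$\ell_{n,k}\;\le\; I_\lambda+\frac{k}{n}\log\left(\frac{k}{n}\right)\;\le\; -\frac{n-k}{n}\log\left(\frac{1}{n}\right),$$ where $\ell_{n,k}=0$ if $k=n$, and $\ell_{n,k}=-\frac{n-k}{n}\log\left(\frac{n-k}{n}\right)$ if $k<n$.
   Context: Graphs are finite, undirected, connected, without loops or multiple edges, with vertex set $V=\{v_1,\dots,v_n\}$. Let $\mathbf{A}$ be the adjacency matrix, $\mathbf{D}$ the diagonal matrix of vertex degrees, $\mathbf{I}$ the identity and $\mathbf{J}$ the all-ones matrix, all $n\times n$. A universal adjacency matrix of $G$ is a matrix $\mathbf{U}=\gamma_A\mathbf{A}+\gamma_D\mathbf{D}+\gamma_I\mathbf{I}+\gamma_J\mathbf{J}$ with real scalars $\gamma_A\neq 0,\gamma_D,\gamma_I,\gamma_J$. For an eigenvalue $\lambda$ of $\mathbf{U}$, a vertex $v_i$ is a $\lambda$-core vertex if there is an eigenvector $\mathbf{x}$ with $\mathbf{U}\mathbf{x}=\lambda\mathbf{x}$ whose $i$-th entry is non-zero. $CV_\lambda$ denotes the set of $\lambda$-core vertices. With $d(u,v)$ the length of a shortest path between $u$ and $v$, define $d_\lambda(v)=\min\{d(v,u): u\in CV_\lambda\}$, $D_\lambda=\max\{d_\lambda(v): v\in V\}$, and $V_{\lambda,i}=\{v\in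 V: d_\lambda(v)=i\}$ for $0\le i\le D_\lambda$; in particular $V_{\lambda,0}=CV_\lambda$. The sets $V_{\lambda,0},\dots,V_{\lambda,D_\lambda}$ partition $V$. The entropy of this partition is $I_\lambda=-\sum_{i=0}^{D_\lambda}\frac{|V_{\lambda,i}|}{n}\log\left(\frac{|V_{\lambda,i}|}{n}\right)$. Logarithms are to a fixed base greater than $1$ (typically $2$, $e$ or $10$). *)

(* Defs.v *)
From HB Require Import structures.
From mathcomp Require Import all_boot all_order all_algebra.
From mathcomp Require Import boolp reals exp.

Set Implicit Arguments.
Unset Strict Implicit.
Unset Printing Implicit Defensive.

Import Order.TTheory GRing.Theory Num.Theory.
Local Open Scope ring_scope.

(* A graph on n vertices is its adjacency relation [e : rel 'I_n]; symmetry,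
   irreflexivity and connectedness are hypotheses of the theorem. *)

Section Graph.
Variables (n : nat) (e : rel 'I_n).

Definition connected_graph : Prop := forall u v : 'I_n, connect e u v.

Definition degree (v : 'I_n) : nat := #|[set w : 'I_n | e v w]|.

Definition has_path_of_length (u v : 'I_n) (k : nat) : bool :=
  [exists p : k.-tuple 'I_n,
    [&& path e u p, uniq (u :: p) & last u p == v]].

(* [find] returns the least admissible length below n, and n if there is none;
   a path has at most n - 1 edges, so n occurs only for disconnected u, v. *)
Definition dist (u v : 'I_n) : nat := find (has_path_of_length u v) (iota 0 n).

End Graph.

Section UniversalAdjacency.
Variables (R : realType) (n : nat) (e : rel 'I_n).

Definition adjacency_mx : 'M[R]_n := \matrix_(i, j) (e i j)%:R.

Definition degree_mx : 'M[R]_n := diag_mx (\row_i (degree e i)%:R).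

Definition universal_adjacency_mx (gA gD gI gJ : R) : 'M[R]_n :=
  gA *: adjacency_mx + gD *: degree_mx + gI *: 1%:M + gJ *: const_mx 1.

End UniversalAdjacency.

Section CoreVertices.
Variables (R : realType) (n : nat) (e : rel 'I_n) (U : 'M[R]_n) (lambda : R).

Definition is_eigenvector (x : 'cV[R]_n) : Prop :=
  x != 0 /\ U *m x = lambda *: x.

Definition core_vertices : {set 'I_n} :=
  [set v | `[< exists x : 'cV[R]_n, is_eigenvector x /\ x v 0 != 0 >]].

(* The neutral element n is never attained when the graph is connected and
   lambda is an eigenvalue: all distances are then less than n. *)
Definition core_dist (v : 'I_n) : nat :=
  \big[minn/n]_(u in core_vertices) dist e v u.

Definition max_core_dist : nat := \max_(v < n) core_dist v.

Definition core_layer (i : nat) : {set 'I_n} := [set v | core_dist v == i].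

End CoreVertices.

Definition logb (R : realType) (b x : R) : R := ln x / ln b.

Definition core_entropy (R : realType) (b : R) (n : nat) (e : rel 'I_n)
    (U : 'M[R]_n) (lambda : R) : R :=
  - \sum_(0 <= i < (max_core_dist e U lambda).+1)
      (#|core_layer e U lambda i|%:R / n%:R) *
      logb b (#|core_layer e U lambda i|%:R / n%:R).

Definition ell (R : realType) (b : R) (n k : nat) : R :=
  if k == n then 0
  else - ((n%:R - k%:R) / n%:R * logb b ((n%:R - k%:R) / n%:R)).

(* Main.v *)
(* The layer of index 0 is the core itself, so the middle quantity is the sum
   of -p log p over the other layers, whose proportions p add up to (n-k)/n.
   Each nonempty one satisfies 1/n <= p <= (n-k)/n; monotonicity of the
   logarithm gives both bounds. *)

Require Import Defs.
From HB Require Import structures.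
From mathcomp Require Import all_boot all_order all_algebra.
From mathcomp Require Import boolp reals exp.

Set Implicit Arguments.
Unset Strict Implicit.
Unset Printing Implicit Defensive.

Import Order.TTheory GRing.Theory Num.Theory.
Local Open Scope ring_scope.

Section XLogX.
Variables (R : realType) (b : R) (b_gt1 : 1 < b).

Lemma ler_logb (x y : R) : 0 < x -> x <= y -> logb b x <= logb b y.
Proof.
move=> x_gt0 le_xy; rewrite /logb ler_pM2r ?invr_gt0 ?ln_gt0 //.
by rewrite ler_ln // posrE (lt_le_trans x_gt0).
Qed.

Variables (I : Type) (r : seq I) (x : I -> R).

(** By induction: the head and the sum of the tail are each at most the whole sum, so both
    logarithms can be raised to that of the whole. *)
Lemma sum_mul_logb_le : (forall i, 0 <= x i) ->
  \sum_(i <- r) x i * logb b (x i)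
    <= (\sum_(i <- r) x i) * logb b (\sum_(i <- r) x i).
Proof.
elim: r => [|i s IHs] x_ge0; first by rewrite !big_nil mul0r.
rewrite !big_cons mulrDl.
have s_ge0 : 0 <= \sum_(j <- s) x j by apply: sumr_ge0.
(* [ler_logb] needs a positive argument; at [y = 0] the factor [y] kills both sides, whatever
   [logb b 0] is. *)
have mul_logb_le (y z : R) : 0 <= y -> y <= z -> y * logb b y <= y * logb b z.
  rewrite le0r => /predU1P[->|y_gt0] le_yz; first by rewrite !mul0r.
  by rewrite ler_wpM2l ?ler_logb // ltW.
apply: lerD; first by rewrite mul_logb_le ?lerDl.
by apply: le_trans (IHs x_ge0) _; rewrite mul_logb_le ?lerDr.
Qed.

(** Holds term by term. The alternative [x i = 0] accommodates empty layers, whose terms vanish on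
    both sides. *)
Lemma sum_mul_logb_ge (m : R) : 0 < m ->
  (forall i, x i = 0 \/ m <= x i) ->
  (\sum_(i <- r) x i) * logb b m <= \sum_(i <- r) x i * logb b (x i).
Proof.
move=> m_gt0 x_ge_m; rewrite mulr_suml; apply: ler_sum => i _.
have [->|le_mx] := x_ge_m i; first by rewrite !mul0r.
by rewrite ler_wpM2l ?ler_logb // (le_trans (ltW m_gt0)).
Qed.

End XLogX.

Section Layers.
Variables (R : realType) (n : nat) (e : rel 'I_n) (U : 'M[R]_n) (lambda : R).

Lemma dist_eq0 (u v : 'I_n) : (dist e u v == 0%N) = (u == v).
Proof.
have n_gt0 : (0 < n)%N by apply: leq_ltn_trans (ltn_ord u).
(* Exposes length 0 as the first candidate of the search; only the empty path has this length. *)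
have iotaE m : (0 < m)%N -> iota 0 m = 0%N :: iota 1 m.-1 by case: m.
rewrite /dist iotaE //=.
suff -> : has_path_of_length e u v 0 = (u == v) by case: (u == v).
apply/existsP/idP => [[p]|/eqP->]; first by rewrite (tuple0 p) => /and3P[].
by exists [tuple]; rewrite /= eqxx.
Qed.

Lemma core_layer0 : core_layer e U lambda 0 = core_vertices U lambda.
Proof.
apply/setP => v; rewrite inE.
have n_gt0 : (0 < n)%N by apply: leq_ltn_trans (ltn_ord v).
(* A minimum is 0 iff some argument is, so testing against 0 turns the iterated [minn] into a
   disjunction over the core; the neutral [n] becomes [false] since [n > 0]. *)
have min0 : {morph eq_op^~ 0%N : l m / minn l m >-> l || m}.
  by move=> [|l] [|m] //; rewrite minnSS.
have n_neq0 : (n == 0)%N = false by rewrite gtn_eqF.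
rewrite /core_dist (big_morph _ min0 n_neq0).
under eq_bigr do rewrite dist_eq0.
rewrite big_orE; apply/exists_inP/idP => [[u u_core /eqP->] //|v_core].
by exists v.
Qed.

(** Double counting: after the sums are exchanged, each vertex [v] counts once, at the index
    [core_dist v], which the maximum keeps in range. *)
Lemma sum_card_core_layer :
  (\sum_(0 <= i < (max_core_dist e U lambda).+1) #|core_layer e U lambda i| = n)%N.
Proof.
transitivity (\sum_(v < n) 1)%N; last by rewrite sum1_card card_ord.
under eq_bigr do rewrite -sum1_card big_mkcond.
rewrite exchange_big; apply: eq_bigr => v _ /=.
under eq_bigr do rewrite inE eq_sym.
rewrite -big_mkcond big_nat1_eq /=.
by rewrite ltnS /max_core_dist (leq_bigmax v).
Qed.

End Layers.

Theorem proposition3p6 (R : realType) (b : R) (hb : 1 < b)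
    (n : nat) (e : rel 'I_n)
    (e_sym : symmetric e) (e_irr : irreflexive e) (e_conn : connected_graph e)
    (gA gD gI gJ : R) (hgA : gA != 0)
    (U : 'M[R]_n) (hU : U = universal_adjacency_mx e gA gD gI gJ)
    (lambda : R) (hlambda : eigenvalue U lambda)
    (k : nat) (hk : #|core_vertices U lambda| = k) (hkn : (1 <= k <= n)%N) :
  ell b n k <= core_entropy b e U lambda + k%:R / n%:R * logb b (k%:R / n%:R)
  /\ core_entropy b e U lambda + k%:R / n%:R * logb b (k%:R / n%:R)
     <= - ((n%:R - k%:R) / n%:R * logb b (1 / n%:R)).
Proof.
case/andP: hkn => k_gt0 k_le_n.
have n_gt0 : 0 < n%:R :> R by rewrite ltr0n (leq_trans k_gt0).
pose p i : R := #|core_layer e U lambda i|%:R / n%:R.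
pose s := \sum_(1 <= i < (max_core_dist e U lambda).+1) p i.
have p0E : p 0%N = k%:R / n%:R by rewrite /p core_layer0 hk.
have sE : s = (n%:R - k%:R) / n%:R.
  (* Adding the core's proportion to both sides completes [s] to the sum over all layers. *)
  apply: (addrI (p 0%N)); rewrite -big_ltn // -mulr_suml -natr_sum.
  by rewrite sum_card_core_layer p0E -mulrDl addrC subrK.
have -> : core_entropy b e U lambda + k%:R / n%:R * logb b (k%:R / n%:R)
    = - \sum_(1 <= i < (max_core_dist e U lambda).+1) p i * logb b (p i).
  by rewrite /core_entropy big_ltn // -p0E opprD addrAC addNr add0r.
have -> : ell b n k = - (s * logb b s).
  (* When [k = n], [s] is 0 and the product agrees with the value 0 set in [ell]. *)
  by rewrite /ell sE; case: eqP => // ->; rewrite subrr !mul0r oppr0.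
rewrite -sE !lerN2; split.
  by apply: sum_mul_logb_le => // i; rewrite divr_ge0 ?ler0n.
apply: sum_mul_logb_ge => // [|i]; first by rewrite divr_gt0.
(* A layer is empty or has at least one vertex, hence proportion at least [1 / n]. *)
rewrite /p; case: #|_| => [|m]; first by left; rewrite mul0r.
by right; rewrite ler_pM2r ?invr_gt0 // ler1n.
Qed.
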